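(* Let $L$ be a fixed real symmetric $n\times n$ matrix and, for $Q=(Q_1,\dots,Q_n)\in\mathbb{R}^n$, let $L_Q=L+\operatorname{diag}(Q_1,\dots,Q_n)$. Assume that $Q$ is distributed according to a probability measure on $\mathbb{R}^n$ that is absolutely continuous with respect to Lebesgue measure. Then, almost surely, the spectrum of $L_Q$ is a $B_2$-set.
   Context: The spectrum of a real symmetric $n\times n$ matrix, with eigenvalues $\lambda_1,\dots,\lambda_n$ counted with multiplicity, is called a $B_2$-set if $\lambda_j+\lambda_k=\lambda_{j'}+\lambda_{k'}$ holds if and only if $\{j,k\}=\{j',k'\}$ (in particular the eigenvalues are simple). *)

(* Defs.v *)
From HB Require Import structures.
From mathcomp Require Import all_boot all_order all_algebra.
From mathcomp Require Import all_classical all_reals all_analysis.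

Set Implicit Arguments.
Unset Strict Implicit.
Unset Printing Implicit Defensive.

Import Order.TTheory GRing.Theory Num.Theory.
Import numFieldNormedType.Exports.

Local Open Scope classical_set_scope.
Local Open Scope ring_scope.

Definition tuple_cons (T : Type) n (x : T * n.-tuple T) : n.+1.-tuple T :=
  [tuple of x.1 :: x.2].

(* Lebesgue measure on R^n, carried by the product (= Borel) sigma-algebra of
   n.-tuple R: the n-fold product of the one-dimensional Lebesgue measure.
   It is the point mass when n = 0. *)
Fixpoint lebesgue_tuple (R : realType) (n : nat) : set (n.-tuple R) -> \bar R :=
  match n return set (n.-tuple R) -> \bar R with
  | 0 => \d_[tuple]
  | m.+1 => pushforward (lebesgue_measure \x lebesgue_tuple (R := R) (n := m))%E
              (@tuple_cons R m)
  end.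
Arguments lebesgue_tuple R n : clear implicits.

Lemma measurable_tuple_cons (R : realType) n :
  measurable_fun setT (@tuple_cons R n : measurableTypeR R * n.-tuple R -> _).
Proof. exact: (measurable_cons measurable_fst measurable_snd). Qed.

Lemma measurable_tuple_box (R : realType) n (A : 'I_n -> set R) :
  (forall i, measurable (A i)) ->
  measurable [set x : n.-tuple R | forall i, A i (tnth x i)].
Proof.
move=> mA.
rewrite (_ : mkset _ = \bigcap_(i : 'I_n) (@tnth n R ^~ i @^-1` A i)).
  apply: fin_bigcap_measurable => [|i _]; first exact: finite_finset.
  by rewrite -[X in measurable X]setTI; exact: measurable_tnth.
by apply/seteqP; split => [x xA i _|x xA i]; [exact: xA|exact: (xA i)].
Qed.

Section lebesgue_tuple_measure.
Context (R : realType).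
Local Open Scope ereal_scope.

Let lebesgue_tuple_ex n :
  exists mu : {sigma_finite_measure set (n.-tuple R) -> \bar R},
    mu = lebesgue_tuple R n :> (set _ -> _).
Proof.
elim: n => [|n [mu muE]]; first by exists (\d_([tuple] : 0.-tuple R)).
pose leb : {sigma_finite_measure set (measurableTypeR R) -> \bar R} :=
  lebesgue_measure.
pose m : {measure set (n.+1.-tuple R) -> \bar R} :=
  measure_function_pushforward__canonical__measure_function_Measure
    (leb \x mu) (@measurable_tuple_cons R n).
have m_sf : sigma_finite setT m.
  have /sigma_finiteP[F [FT ndF Foo]] := sigma_finiteT leb.
  have /sigma_finiteP[G [GT ndG Goo]] := sigma_finiteT mu.
  pose H k := [set t : n.+1.-tuple R | F k (thead t) /\
                                       G k [tuple of behead t]].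
  exists H.
    apply/seteqP; split => // t _.
    have : setT (thead t) by []. rewrite FT => -[i _ Fi].
    have : setT [tuple of behead t] by []. rewrite GT => -[j _ Gj].
    exists (maxn i j) => //; split.
      by move: Fi; exact/subsetPset/ndF/leq_maxl.
    by move: Gj; exact/subsetPset/ndG/leq_maxr.
  move=> k; have [mF Fk] := Foo k; have [mG Gk] := Goo k; split.
    apply: measurableI; rewrite -[X in measurable X]setTI.
      exact: (@measurable_tnth _ R n.+1 ord0).
    exact: measurable_behead.
  rewrite [ltLHS](_ : _ = (leb \x mu) (F k `*` G k)).
    by rewrite product_measure1E// lte_mul_pinfty// ge0_fin_numE.
  rewrite /= /pushforward; congr (_ _).
  have consK (x : R) (t : n.-tuple R) : [tuple of behead [tuple of x :: t]] = t.
    exact: val_inj.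
  by apply/seteqP; split => -[x t]; rewrite /H /= theadE consK.
pose nu : {sigma_finite_measure set (n.+1.-tuple R) -> \bar R} :=
  HB.pack (m : set _ -> _) (Measure.class m)
   (Measure_isSigmaFinite.Build _ _ _ m m_sf).
by exists nu; rewrite /= -muE.
Qed.

Section instances.
Variable n : nat.

Let lebesgue_tuple0 : lebesgue_tuple R n set0 = 0.
Proof. by have [mu <-] := lebesgue_tuple_ex n; exact: measure0. Qed.

Let lebesgue_tuple_ge0 A : 0 <= lebesgue_tuple R n A.
Proof. by have [mu <-] := lebesgue_tuple_ex n; exact: measure_ge0. Qed.

Let lebesgue_tuple_sigma_additive : semi_sigma_additive (lebesgue_tuple R n).
Proof.
by have [mu <-] := lebesgue_tuple_ex n; exact: measure_semi_sigma_additive.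
Qed.

HB.instance Definition _ := isMeasure.Build _ _ _ (lebesgue_tuple R n)
  lebesgue_tuple0 lebesgue_tuple_ge0 lebesgue_tuple_sigma_additive.

Let lebesgue_tuple_sigma_finite : sigma_finite setT (lebesgue_tuple R n).
Proof. by have [mu <-] := lebesgue_tuple_ex n; exact: sigma_finiteT. Qed.

HB.instance Definition _ := Measure_isSigmaFinite.Build _ _ _
  (lebesgue_tuple R n) lebesgue_tuple_sigma_finite.

End instances.

Lemma lebesgue_tuple_box n (A : 'I_n -> set R) :
  (forall i, measurable (A i)) ->
  lebesgue_tuple R n [set x | forall i, A i (tnth x i)] =
  \prod_(i < n) lebesgue_measure (A i).
Proof.
elim: n A => [|n IH] A mA.
  by rewrite big_ord0 /= diracE mem_set // => -[].
rewrite big_ord_recl -IH //= /pushforward.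
have mB := measurable_tuple_box (fun i => mA (lift ord0 i)).
rewrite -(@product_measure1E _ _ (measurableTypeR R)) //; last exact: mA.
congr (_ _); apply/seteqP; split => -[x t] /=.
  move=> xtA; split=> [|i]; [exact: (xtA ord0)|].
  by have := xtA (lift ord0 i); rewrite tnthS.
by move=> [xA tA] i; case: (unliftP ord0 i) => [j|] ->; rewrite ?tnthS.
Qed.

End lebesgue_tuple_measure.

(* The eigenvalues of M, counted with algebraic multiplicity (which for a
   symmetric matrix is also the geometric one), are the lam i. *)
Definition is_spectrum (R : realType) n (M : 'M[R]_n) (lam : 'I_n -> R) :=
  char_poly M = \prod_(i < n) ('X - (lam i)%:P).

Definition is_B2_set (R : realType) n (lam : 'I_n -> R) :=
  forall j k j' k' : 'I_n,
    lam j + lam k = lam j' + lam k' <-> [set j; k]%SET = [set j'; k']%SET.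

(* Both is_spectrum and is_B2_set are invariant under permutations of lam, so
   the choice of the enumeration of the spectrum is irrelevant. *)
Definition has_B2_spectrum (R : realType) n (M : 'M[R]_n) :=
  exists2 lam : 'I_n -> R, is_spectrum M lam & is_B2_set lam.

Definition add_potential (R : realType) n (L : 'M[R]_n) (Q : n.-tuple R) :
  'M[R]_n := L + diag_mx (\row_i tnth Q i).

(* Main.v *)
(* The product b2_gap of all differences (lam_j + lam_k) - (lam_j' + lam_k') over
   pairs with {j,k} <> {j',k'} is a symmetric polynomial in the eigenvalues, hence a
   polynomial in the coefficients of the characteristic polynomial, hence a
   polynomial F in Q, and the spectrum of L_Q is a B_2-set iff F(Q) <> 0. The zero
   set of a nonzero polynomial is Lebesgue-null by Fubini, so it suffices that F is
   not identically zero. The spectrum {3^i} of D = diag(3^i) is a B_2-set, so the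
   polynomial s |-> b2_gap(spec(s L + D)) is nonzero at 0, hence at some s <> 0;
   rescaling by 1/s shows F(diag(D) / s) <> 0. *)
Require Import Defs.
From HB Require Import structures.
From mathcomp Require Import all_boot all_order all_algebra.
From mathcomp Require Import all_classical all_reals all_analysis.
From mathcomp Require Import zify perm spectral complex.
From mathcomp Require Import -(notations) mpoly.

Set Implicit Arguments.
Unset Strict Implicit.
Unset Printing Implicit Defensive.

Import Order.TTheory GRing.Theory Num.Theory.
Import numFieldNormedType.Exports.

Local Open Scope classical_set_scope.
Local Open Scope ring_scope.

(** * Real spectra of symmetric matrices *)

Lemma char_poly_invmx_conj (R : fieldType) n (P A : 'M[R]_n) :
  P \in unitmx -> char_poly (invmx P *m A *m P) = char_poly A.
Proof.
move=> Pu; pose C (M : 'M[R]_n) := map_mx (@polyC R) M.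
have CVK : C (invmx P) *m C P = 1%:M by rewrite /C -map_mxM mulVmx // map_mx1.
rewrite /char_poly /char_poly_mx.
have -> : 'X%:M - C (invmx P *m A *m P) =
    C (invmx P) *m ('X%:M - C A) *m C P.
  rewrite /C !map_mxM mulmxBr mulmxBl; congr (_ - _).
  by rewrite scalar_mxC -mulmxA CVK mulmx1.
by rewrite !det_mulmx mulrAC -det_mulmx CVK det1 mul1r.
Qed.

(** Over the complex numbers the matrix is Hermitian, hence unitarily diagonalizable with real
    diagonal. The factorization descends because [map_poly (real_complex R)] is injective. *)
Lemma symmetric_real_spectrum (R : realType) n (A : 'M[R]_n) :
  A^T = A -> exists lam : 'I_n -> R, is_spectrum A lam.
Proof.
move=> symA; pose B := map_mx (real_complex R) A.
have hermB : B \is hermsymmx.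
  apply/is_hermitianmxP; rewrite expr0 scale1r.
  by apply/matrixP => i j; rewrite !mxE -[in LHS]symA mxE; exact/esym/conjc_real.
have /mxOverP realD := hermitian_spectral_diag_real hermB.
have /orthomx_spectralP BE := hermitian_normalmx hermB.
exists (fun i => complex.Re (spectral_diag B 0 i)).
apply: (map_poly_inj (real_complex R)).
rewrite map_char_poly -/B {1}BE char_poly_invmx_conj ?spectral_unit //.
rewrite char_poly_trig ?diag_mx_is_trig // rmorph_prod.
apply: eq_bigr => i _; rewrite /= rmorphB /= map_polyX map_polyC /=.
rewrite !mxE eqxx mulr1n; congr (_ - _%:P).
by rewrite [LHS]complexE RIm_real ?realD // mulr0 addr0.
Qed.

(** * Detection of $B_2$-sets, and rescaling *)

Definition b2_gap (R : pzRingType) n (lam : 'I_n -> R) : R :=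
  \prod_(q : ('I_n * 'I_n) * ('I_n * 'I_n) |
         [set q.1.1; q.1.2]%SET != [set q.2.1; q.2.2]%SET)
    (lam q.1.1 + lam q.1.2 - (lam q.2.1 + lam q.2.2)).

Lemma set2_eqP (T : finType) (a b c d : T) :
  [set a; b]%SET = [set c; d]%SET -> (a = c /\ b = d) \/ (a = d /\ b = c).
Proof.
move=> E; have := set21 a b; have := set22 a b.
have := set21 c d; have := set22 c d.
rewrite -{1 2}E {3 4}E => /set2P[]dE /set2P[]cE /set2P[]bE /set2P[]aE;
  by [left; split; congruence|right; split; congruence].
Qed.

Lemma is_B2_setP (R : realType) n (lam : 'I_n -> R) :
  is_B2_set lam <-> b2_gap lam != 0.
Proof.
split=> [B2|/prodf_neq0 gap0 j k j' k'].
  apply/prodf_neq0 => -[[j k] [j' k']] /=; apply: contra.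
  by rewrite subr_eq0 => /eqP/B2/eqP.
split=> [eq_lam|/set2_eqP[] [-> ->] //]; last exact: addrC.
apply/eqP/negPn/negP => /(gap0 ((j, k), (j', k')))/eqP; apply.
by rewrite /= eq_lam subrr.
Qed.

(** Every factor is linear in [lam], so the exponent is the number of factors. Its value is left
    existential: only nonvanishing has to survive rescaling. *)
Lemma b2_gapZ (R : comPzRingType) n (lam : 'I_n -> R) c :
  exists m, b2_gap (fun i => c * lam i) = c ^+ m * b2_gap lam.
Proof.
rewrite /b2_gap; set P := BIG_P.
exists #|[pred q | P q]|; rewrite -prodr_const -big_split /=.
by apply: eq_bigr => q _; rewrite mulrBr !mulrDr.
Qed.

(* The larger exponent k is determined by 3^k < 3^j + 3^k < 3^(k+1). *)
Lemma b2_gap_exp3 (R : realType) n : b2_gap (fun i : 'I_n => (3 ^ i)%:R : R) != 0.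
Proof.
apply/is_B2_setP => j k j' k'.
split=> [|/set2_eqP[] [-> ->] //]; last exact: addrC.
rewrite -!natrD => /eqP; rewrite eqr_nat => /eqP.
wlog lejk : j k / (j <= k)%N => [wl|].
  by case: (leqP j k) => [/wl//|/ltnW/wl]; rewrite addnC finset.setUC.
wlog lejk' : j' k' / (j' <= k')%N => [wl|].
  case: (leqP j' k') => [/wl//|/ltnW/wl].
  by rewrite (addnC (3 ^ k')%N) (finset.setUC [set k']%SET).
have up (a b : nat) : (a <= b -> 3 ^ a + 3 ^ b < 3 ^ b.+1)%N.
  move=> ab; rewrite expnS !mulSn mul0n addn0.
  have : (3 ^ a <= 3 ^ b)%N by rewrite leq_exp2l.
  have : (0 < 3 ^ b)%N by rewrite expn_gt0.
  lia.
have lt3 (a b c d : nat) : (a <= b -> 3 ^ a + 3 ^ b = 3 ^ c + 3 ^ d -> d <= b)%N.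
  move=> /up ab E; rewrite -ltnS -(ltn_exp2l _ _ (isT : 1 < 3)%N).
  by apply: leq_ltn_trans ab; rewrite E leq_addl.
move=> E; have kk' : k = k'.
  apply/val_inj/eqP; rewrite eqn_leq (lt3 _ _ _ _ lejk E).
  by rewrite (lt3 _ _ _ _ lejk' (esym E)).
by move: E; rewrite kk' => /addIn/eqP; rewrite eqn_exp2l // => /eqP/val_inj->.
Qed.

(** Substituting $cX$ for $X$ is injective when $c \neq 0$, and it turns $\det(X - cA)$ into
    $\det(cX - cA) = c^n \det(X - A)$. *)
Lemma char_polyZ (R : fieldType) n (A : 'M[R]_n) (lam : 'I_n -> R) c :
  c != 0 -> char_poly A = \prod_(i < n) ('X - (lam i)%:P) ->
  char_poly (c *: A) = \prod_(i < n) ('X - (c * lam i)%:P).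
Proof.
move=> c0 EA; have cK : cancel (comp_poly (c *: 'X)) (comp_poly (c^-1 *: 'X)).
  move=> p; rewrite -comp_polyA comp_polyZ comp_polyX scalerA divff //.
  by rewrite scale1r comp_polyXr.
apply: (can_inj cK).
have -> : char_poly (c *: A) \Po (c *: 'X) = c%:P ^+ n * char_poly A.
  rewrite -detZ -det_map_mx; congr (\det _).
  apply/matrixP => i j; rewrite !mxE /= rmorphB /= rmorphMn /= comp_polyX comp_polyC.
  by rewrite mulrBr mulrnAr mul_polyC polyCM.
rewrite EA rmorph_prod -{1}(card_ord n) -prodr_const -big_split /=.
apply: eq_bigr => i _.
by rewrite rmorphB /= comp_polyX comp_polyC mulrBr mul_polyC polyCM.
Qed.

(** * Characteristic polynomials over an algebra of functions *)

(** Keeping [S] abstract lets one argument serve both for functions of the potential in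
    $\mathbb{R}^n$ and for polynomial functions of one real parameter. *)
Definition function_subalgebra (R : pzRingType) T (S : (T -> R) -> Prop) :=
  [/\ forall c, S (fun=> c),
      forall f g, S f -> S g -> S (fun t => f t + g t) &
      forall f g, S f -> S g -> S (fun t => f t * g t)].

Section function_subalgebra.
Variables (R : comNzRingType) (T : Type) (S : (T -> R) -> Prop).
Hypothesis algS : function_subalgebra S.

Lemma function_subalgebra_sum (I : Type) (r : seq I) (P : pred I) (F : I -> T -> R) :
  (forall i, P i -> S (F i)) -> S (fun t => \sum_(i <- r | P i) F i t).
Proof.
case: algS => Sc SD _ SF; elim: r => [|i r IH].
  by under eq_fun do rewrite big_nil; exact: Sc.
under eq_fun do rewrite big_cons.
by case Pi: (P i) => //; apply: SD => //; exact: SF.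
Qed.

Lemma function_subalgebra_prod (I : Type) (r : seq I) (P : pred I) (F : I -> T -> R) :
  (forall i, P i -> S (F i)) -> S (fun t => \prod_(i <- r | P i) F i t).
Proof.
case: algS => Sc _ SM SF; elim: r => [|i r IH].
  by under eq_fun do rewrite big_nil; exact: Sc.
under eq_fun do rewrite big_cons.
by case Pi: (P i) => //; apply: SM => //; exact: SF.
Qed.

Lemma function_subalgebra_meval n (p : mpoly n R) (v : T -> 'I_n -> R) :
  (forall i, S (v ^~ i)) -> S (fun t => meval (v t) p).
Proof.
move=> Sv; under eq_fun do rewrite mevalE.
apply: function_subalgebra_sum => m _; case: algS => Sc _; apply => //.
apply: function_subalgebra_prod => i _.
under eq_fun do rewrite -[m i]card_ord -prodr_const.
exact: function_subalgebra_prod.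
Qed.

Let coefS (p : T -> {poly R}) := forall i, S (fun t => (p t)`_i).

Lemma function_subalgebra_char_poly n (M : T -> 'M[R]_n) k :
  (forall i j, S (fun t => M t i j)) -> S (fun t => (char_poly (M t))`_k).
Proof.
move=> SM; have [Sc SD SMul] := algS.
have coefc (p : {poly R}) : coefS (fun=> p) by move=> i; exact: Sc.
have SprodP p q : coefS p -> coefS q -> coefS (fun t => p t * q t).
  move=> Sp Sq i; under eq_fun do rewrite coefM.
  by apply: function_subalgebra_sum => j _; exact: SMul.
(* Leibniz expansion: each term is a constant sign times a product of entries of [char_poly_mx],
   whose coefficients lie in [S]. *)
rewrite /char_poly /determinant; under eq_fun do rewrite coef_sum.
apply: function_subalgebra_sum => s _; apply: (SprodP (fun=> _)) => // {}k.
(* The degree [k] stays general in the induction, since a coefficient of a product involves all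
   lower coefficients of its factors. *)
elim: (index_enum _) k => [|i r IH] k.
  by under eq_fun do rewrite big_nil; exact: Sc.
under eq_fun do rewrite big_cons.
apply: (SprodP (fun t => char_poly_mx (M t) i (s i))) => // {}k.
under eq_fun do rewrite !mxE coefB coefC; apply: SD => //.
under eq_fun do rewrite -mulN1r; apply: SMul => //.
by case: (k == 0%N).
Qed.

End function_subalgebra.

(* By Viete, the arguments of t are the elementary symmetric functions of lam. *)
Lemma b2_gap_charpoly (R : idomainType) n : exists t : mpoly n R,
  forall (p : {poly R}) (lam : 'I_n -> R), p = \prod_(i < n) ('X - (lam i)%:P) ->
  b2_gap lam = meval (fun i : 'I_n => (-1) ^+ i.+1 * p`_(n - i.+1)) t.
Proof.
pose X i : mpoly n R := mpolyX R (mnm1 i).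
have symD : b2_gap X \is symmetric.
  apply/issymP => s; rewrite /b2_gap rmorph_prod /=.
  (* A permutation of the variables permutes the quadruples of indices, and by injectivity it
     preserves the condition that the two pairs differ. *)
  pose sig (f : {perm 'I_n}) (q : ('I_n * 'I_n) * ('I_n * 'I_n)) :=
    ((f q.1.1, f q.1.2), (f q.2.1, f q.2.2)).
  have sigK f : cancel (sig f) (sig (f^-1)%g).
    by move=> [[a b] [c e]]; rewrite /sig /= !permK.
  have sigVK f : cancel (sig (f^-1)%g) (sig f).
    by move=> [[a b] [c e]]; rewrite /sig /= !permKV.
  rewrite [RHS](reindex (sig s)) /=; last first.
    by exists (sig (s^-1)%g) => q _; rewrite ?sigK ?sigVK.
  apply: eq_big => [q|q _].
    have im (a b : 'I_n) : [set s a; s b]%SET = s @: [set a; b]%SET.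
      by rewrite imsetU1 imset_set1.
    by rewrite /= !im (inj_eq (imset_inj (@perm_inj _ s))).
  have symX i : msym s (X i) = X (s i).
    rewrite /X msymX; congr mpolyX; apply/mnmP => j.
    rewrite mnmE !mnm1E; congr (nat_of_bool _).
    by rewrite -(inj_eq (@perm_inj _ s)) permKV.
  by rewrite rmorphB !rmorphD /= !symX.
have [t [tE _]] := sym_fundamental symD.
exists t => p lam pE.
have -> : b2_gap lam = meval lam (b2_gap X).
  rewrite /b2_gap rmorph_prod; apply: eq_bigr => q _.
  by rewrite rmorphB !rmorphD /= !mevalXU.
rewrite -tE comp_mpoly_meval; congr meval; apply/funext => i.
rewrite tnth_mktuple.
(* The ordinal [i] starts at 0 while the arguments of [t] start at $e_1$, hence the shift to [i.+1].
   The sign in the statement cancels the one in Viete's formula. *)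
have i1 : (i.+1 < n.+1)%N by rewrite ltnS.
have := mroots_coeff [tuple lam i | i < n] (Ordinal i1).
have -> : tnth [tuple lam i | i < n] = lam.
  by apply/funext => j; rewrite tnth_mktuple.
rewrite big_tuple; under eq_bigr do rewrite tnth_mktuple.
by rewrite /= -pE => ->; rewrite mulrA -expr2 sqrr_sign mul1r.
Qed.

(** * Null zero sets by Fubini *)

(** A substitute for polynomials in $n$ variables that keeps just what the Fubini argument uses:
    measurability, and a polynomial restriction to each parametrized line. *)
Definition polynomial_on_lines (R : realType) n (f : n.-tuple R -> R) :=
  measurable_fun setT f /\
  forall a b : 'I_n -> R, exists p : {poly R},
    forall s, f [tuple a i + s * b i | i < n] = p.[s].

Lemma polynomial_on_lines_subalgebra (R : realType) n :
  function_subalgebra (@polynomial_on_lines R n).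
Proof.
split=> [c|f g [mf lf] [mg lg]|f g [mf lf] [mg lg]].
- by split=> [|a b]; [exact: measurable_cst|exists c%:P => s; rewrite hornerC].
- split=> [|a b]; first exact: measurable_realfun.measurable_funD.
  have [[p pE] [q qE]] := (lf a b, lg a b).
  by exists (p + q) => s; rewrite hornerD pE qE.
- split=> [|a b]; first exact: measurable_realfun.measurable_funM.
  have [[p pE] [q qE]] := (lf a b, lg a b).
  by exists (p * q) => s; rewrite hornerM pE qE.
Qed.

Lemma polynomial_on_lines_tnth (R : realType) n (i : 'I_n) :
  polynomial_on_lines (fun t : n.-tuple R => tnth t i).
Proof.
split=> [|a b]; first exact: measurable_tnth.
exists ((a i)%:P + 'X * (b i)%:P) => s.
by rewrite tnth_mktuple !hornerE.
Qed.

Lemma countable_poly_roots (R : realType) (p : {poly R}) :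
  p != 0 -> countable [set x | p.[x] = 0].
Proof.
move=> p0; apply: finite_set_countable; apply: contrapT => /infinite_set_fset.
move=> /(_ (size p))[X Xp]; rewrite leqNgt => /negP; apply.
apply: max_poly_roots => //; last exact: finmap.fset_uniq.
by apply/allP => x xX; apply/rootP; exact: Xp.
Qed.

(** Induction on the dimension, slicing by the first coordinate. On the line through [t0] along the
    first axis, [f] is a nonzero polynomial [p]; away from its countably many roots, the slice at
    [x] contains a point where [f] does not vanish, so its zero set is null by induction. *)
Lemma polynomial_on_lines_null (R : realType) n (f : n.-tuple R -> R) t0 :
  polynomial_on_lines f -> f t0 != 0 ->
  lebesgue_tuple R n [set t | f t = 0] = 0%E.
Proof.
elim: n f t0 => [|n IH] f t0 [mf lf] ft0.
  rewrite (_ : [set _ | _] = set0) ?measure0 //.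
  apply/seteqP; split=> // t /= ft; case/eqP: ft0.
  by rewrite (tuple0 t0) -(tuple0 t).
have mZ : measurable [set t | f t = 0].
  by rewrite -[X in measurable X]setTI; exact: (mf measurableT [set 0]).
(* The base point has first coordinate 0, so that the parameter of the line is the first coordinate
   itself. *)
have [p pE] := lf (fun i => if i == ord0 then 0 else tnth t0 i)
                  (fun i => (i == ord0)%:R).
have {}pE s : f [tuple of s :: behead t0] = p.[s].
  rewrite -pE; congr f; apply: eq_from_tnth => i; rewrite tnth_mktuple.
  case: (unliftP ord0 i) => [j ->|->].
    rewrite tnthS /= mulr0 addr0 tnth_behead; congr tnth.
    by apply/val_inj; rewrite /= inordK // ltnS; exact: (ltn_ord j).
  by rewrite /= tnth0 add0r mulr1.
have p0 : p != 0.
  apply: contraNneq ft0 => p0; rewrite (tuple_eta t0) pE p0 horner0 //.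
have secnull x : p.[x] != 0 ->
    lebesgue_tuple R n (xsection (@tuple_cons R n @^-1` [set t | f t = 0]) x) = 0%E.
  move=> px; rewrite -[RHS](IH (fun t => f [tuple of x :: t]) [tuple of behead t0]).
  - congr (lebesgue_tuple _ _ _); apply/seteqP.
    by split=> t; rewrite /xsection /= inE.
  - split=> [|a b].
      apply: (measurableT_comp mf).
      exact: (@measurable_cons _ _ _ _ (cst x) n id).
    (* A line in the slice is lifted to $\mathbb{R}^{n+1}$: the default values [x] and [0] of [oapp]
       freeze the first coordinate at [x]. *)
    have [q qE] := lf (fun i => oapp a x (unlift ord0 i))
                      (fun i => oapp b 0 (unlift ord0 i)).
    exists q => s; rewrite -qE; congr f; apply: eq_from_tnth => i.
    rewrite tnth_mktuple; case: (unliftP ord0 i) => [j ->|->] /=.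
      by rewrite tnthS tnth_mktuple.
    by rewrite tnth0 mulr0 addr0.
  - by rewrite pE.
have mcons : measurable (@tuple_cons R n @^-1` [set t | f t = 0]).
  by rewrite -[X in measurable X]setTI; exact: measurable_tuple_cons.
rewrite /= /pushforward /product_measure1.
rewrite (@ae_eq_integral _ _ _ _ _ (cst 0%E)) ?integral_cst ?mul0e //.
- exact: measurable_fun_xsection.
exists [set x | p.[x] = 0]; split.
- apply: countable_measurable => [t|]; first exact: measurable_set1.
  exact: countable_poly_roots.
- exact/countable_lebesgue_measure0/countable_poly_roots.
- move=> x /= nx; apply: contrapT => /eqP px; apply: nx => _.
  exact: secnull.
Qed.

(** * A potential with $B_2$ spectrum, and the almost sure statement *)

Definition polynomial_function (R : nzSemiRingType) (f : R -> R) :=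
  exists p : {poly R}, f = horner p.

Lemma horner_subalgebra (R : comNzRingType) :
  function_subalgebra (@polynomial_function R).
Proof.
split=> [c|_ _ [p ->] [q ->]|_ _ [p ->] [q ->]].
- by exists c%:P; apply/funext => x; rewrite hornerC.
- by exists (p + q); apply/funext => x; rewrite hornerD.
- by exists (p * q); apply/funext => x; rewrite hornerM.
Qed.

Lemma add_potential_sym (R : realType) n (L : 'M[R]_n) (Q : n.-tuple R) :
  L^T = L -> (add_potential L Q)^T = add_potential L Q.
Proof. by move=> symL; rewrite /add_potential linearD /= symL tr_diag_mx. Qed.

Lemma exists_b2_potential (R : realType) n (L : 'M[R]_n) : L^T = L ->
  exists (Q : n.-tuple R) (lam : 'I_n -> R),
    is_spectrum (add_potential L Q) lam /\ b2_gap lam != 0.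
Proof.
move=> symL; pose d := [tuple (3 ^ i)%:R : R | i < n].
pose M s := add_potential (s *: L) d.
have [t tE] := b2_gap_charpoly R n.
pose G (s : R) :=
  meval (fun i : 'I_n => (-1) ^+ i.+1 * (char_poly (M s))`_(n - i.+1)) t.
have [p GE] : polynomial_function G.
  apply: (function_subalgebra_meval (horner_subalgebra R)) => i.
  have [Sc SD SM] := horner_subalgebra R; apply: (SM); first exact: Sc.
  apply: (function_subalgebra_char_poly (M := M) (horner_subalgebra R)) => k l.
  under eq_fun do rewrite /M /add_potential 2!mxE.
  by apply: SD; [apply: SM; [exists 'X; apply/funext => x; rewrite hornerX|]|].
have p0 : p != 0.
  apply: contraNneq (b2_gap_exp3 R n) => p0.
  rewrite (tE (char_poly (M 0))); first by rewrite -/(G 0) GE p0 horner0.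
  rewrite /M /add_potential scale0r add0r char_poly_trig ?diag_mx_is_trig //.
  by apply: eq_bigr => i _; rewrite !mxE eqxx mulr1n tnth_mktuple.
(* The factor ['X] forces [s] to be nonzero as well as a non-root of [p]. Such an [s] exists because
   the naturals below [size ('X * p)] are too many to be all roots. *)
have [s /eqP] : exists s, ('X * p).[s] <> 0.
  apply/existsNP => Xp0; have Xp : 'X * p != 0 by rewrite mulf_neq0 ?polyX_eq0.
  have := @max_poly_roots _ _ [seq k%:R | k <- iota 0 (size ('X * p))] Xp.
  rewrite size_map size_iota ltnn => absurd; apply/notF/absurd.
    by apply/allP => x _; apply/rootP; exact: Xp0.
  by rewrite map_inj_uniq ?iota_uniq // => a b /eqP; rewrite eqr_nat => /eqP.
rewrite hornerM hornerX mulf_eq0 negb_or => /andP[s0 ps].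
have symM : (M s)^T = M s by apply: add_potential_sym; rewrite linearZ /= symL.
have [lam lamE] := symmetric_real_spectrum symM.
exists [tuple s^-1 * tnth d i | i < n], (fun i => s^-1 * lam i); split.
  (* With $D$ the diagonal matrix of [d], $L + s^{-1}D = s^{-1}(sL + D)$. *)
  have -> : add_potential L [tuple s^-1 * tnth d i | i < n] = s^-1 *: M s.
    apply/matrixP => i j; rewrite !mxE !tnth_mktuple mulrDr mulKf //.
    by rewrite -mulrnAr.
  by apply: (char_polyZ _ lamE); rewrite invr_eq0.
have [m ->] := b2_gapZ lam s^-1.
by rewrite mulf_neq0 ?expf_neq0 ?invr_eq0 // (tE _ _ lamE) -/(G s) GE.
Qed.

Theorem proposition3p3 (R : realType) (n : nat) (L : 'M[R]_n)
    (symL : L^T = L)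
    (d : measure_display) (Omega : measurableType d) (P : probability Omega R)
    (Q : {RV P >-> n.-tuple R})
    (Q_ac : distribution P Q `<< lebesgue_tuple R n) :
  {ae P, forall w, has_B2_spectrum (add_potential L (Q w))}.
Proof.
have [t tE] := b2_gap_charpoly R n.
pose F (q : n.-tuple R) := meval (fun i : 'I_n =>
  (-1) ^+ i.+1 * (char_poly (add_potential L q))`_(n - i.+1)) t.
have polF : polynomial_on_lines F.
  have alg := polynomial_on_lines_subalgebra R n.
  have [Sc SD SM] := alg; apply: (function_subalgebra_meval alg) => i.
  apply: SM; first exact: Sc.
  apply: (function_subalgebra_char_poly (M := add_potential L) alg) => k l.
  under eq_fun do rewrite /add_potential 3!mxE.
  apply: SD => //; case: (k == l); last exact: Sc.
  by under eq_fun do rewrite mulr1n; exact: polynomial_on_lines_tnth.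
have [q [lam [lamE gap0]]] := exists_b2_potential symL.
have Fq : F q != 0 by rewrite /F -(tE _ _ lamE).
pose Z := [set q | F q = 0].
have mZ : measurable Z.
  rewrite -[X in measurable X]setTI; exact: (polF.1 measurableT [set 0]).
have Z0 := polynomial_on_lines_null polF Fq.
(* The preimage of the zero set of [F] is the exceptional event: outside it, any enumeration of the
   real spectrum has nonzero [b2_gap]. *)
exists (Q @^-1` Z); split.
- by rewrite -[X in measurable X]setTI; exact: measurable_funP.
(* [null_set] quantifies over measurable subsets of [Z], hence the appeal to monotonicity. *)
- have nullZ : null_set (lebesgue_tuple R n) Z.
    move=> A mA AZ; apply/eqP; rewrite eq_le measure_ge0 andbT -Z0.
    by rewrite le_measure ?inE.
  exact: (Q_ac _ nullZ).
move=> w /= nB2; apply: contrapT => /eqP FQ; apply: nB2.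
have [mu muE] := symmetric_real_spectrum (add_potential_sym (Q w) symL).
by exists mu => //; apply/is_B2_setP; rewrite (tE _ _ muE).
Qed.
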